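(* Let $(u,v)\in\mathbb{R}_+^2$. On the event $\{T=\infty\}$, $\mathbb{P}_{(u,v)}$-almost surely the process $Z(t)$ tends to infinity as $t\to\infty$, namely $$\mathbb{P}_{(u,v)}\left[\lim_{t\to\infty} Z(t)=\infty \,\middle|\, T=\infty\right]=1.$$ Equivalently, $$\mathbb{P}_{(u,v)}\left[\liminf_{t\to\infty} Z(t)<\infty,\ T=\infty\right]=0.$$
   Context: Fix $\mu_1>0$, $\mu_2>0$, $\rho\in(-1,1)$ and $r_1>0$, $r_2>0$ with $r_1r_2\ge 1$. For $(u,v)\in\mathbb{R}_+^2$, under $\mathbb{P}_{(u,v)}$ the process $Z=(Z_1,Z_2)$ is the obliquely reflected Brownian motion in the quadrant $\mathbb{R}_+^2=[0,\infty)^2$ started at $(u,v)$ and absorbed at the origin. That is, with $T:=\inf\{t>0: Z(t)=(0,0)\}$, for $t\le T$, $$Z_1(t)=u+W_1(t)+\mu_1t+l_1(t)-r_2l_2(t)\ge 0,\qquad Z_2(t)=v+W_2(t)+\mu_2t-r_1l_1(t)+l_2(t)\ge 0,$$ where $(W_1,W_2)$ is a planar Brownian motion started at $0$ with covariance matrix $\begin{pmatrix}1&\rho\\ \rho&1\end{pmatrix}$, and $l_1$ (resp. $l_2$) is a continuous non-decreasing process starting from $0$ which increases only when $Z_1(t)=0$ (resp. $Z_2(t)=0$). For $t>T$ one sets $Z(t)=(0,0)$. Such a process exists and is unique in law. $\lim_{t\to\infty} Z(t)=\infty$ means $\|Z(t)\|\to\infty$, and $\liminf_{t\to\infty} Z(t)<\infty$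 means $\liminf_{t\to\infty}\|Z(t)\|<\infty$. *)

(* Defs.v *)
From HB Require Import structures.
From mathcomp Require Export all_boot all_order all_algebra.
From mathcomp Require Export all_classical all_reals all_analysis.
Export Order.TTheory GRing.Theory Num.Theory.
Export numFieldNormedType.Exports.

Set Implicit Arguments.
Unset Strict Implicit.
Unset Printing Implicit Defensive.

Local Open Scope classical_set_scope.
Local Open Scope ring_scope.

(* Subfamilies are covered by taking A i = setT for the other indices. *)
Definition mutually_independent d (T : measurableType d) (R : realType)
    (P : probability T R) d' (T' : measurableType d') (n : nat)
    (X : 'I_n -> T -> T') :=
  forall A : 'I_n -> set T', (forall i, measurable (A i)) ->
  P (\bigcap_(i in [set: 'I_n]) X i @^-1` A i) =
  (\prod_(i < n) P (X i @^-1` A i))%E.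

(* Nondegenerate centered Gaussian vector (X, Y) with covariance matrix
   [[a, c]; [c, b]]: every nontrivial linear combination is normal with the
   corresponding variance. The second parameter of [normal_prob] is the
   standard deviation; the combination p = q = 0 is left out because
   [normal_prob 0 0] is not the Dirac mass at 0. *)
Definition centered_gaussian2 d (T : measurableType d) (R : realType)
    (P : probability T R) (a b c : R) (X Y : T -> R) :=
  forall p q : R, (p, q) != (0, 0) ->
  forall V : set R, measurable V ->
  P ((fun w => p * X w + q * Y w) @^-1` V) =
  normal_prob 0 (Num.sqrt (p ^+ 2 * a + q ^+ 2 * b + 2 * p * q * c)) V.

(* Processes are indexed by R; only the times t >= 0 are constrained. *)

Definition continuous_path (R : realType) (f : R -> R) :=
  {within `[0, +oo[%classic, continuous f}.

Record planar_BM d (T : measurableType d) (R : realType)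
    (P : probability T R) (rho : R) (W1 W2 : R -> {RV P >-> R}) : Prop := {
  planar_BM0 : forall w, W1 0 w = 0 /\ W2 0 w = 0 ;
  planar_BM_continuous : forall w,
    continuous_path (W1 ^~ w) /\ continuous_path (W2 ^~ w) ;
  planar_BM_gaussian : forall s t : R, 0 <= s -> s < t ->
    centered_gaussian2 P (t - s) (t - s) (rho * (t - s))
      (fun w => W1 t w - W1 s w) (fun w => W2 t w - W2 s w) ;
  planar_BM_independent : forall (n : nat) (t : nat -> R),
    0 <= t 0%N -> {homo t : i j / (i <= j)%N >-> i <= j} ->
    mutually_independent P (fun (i : 'I_n) (w : T) =>
      (W1 (t i.+1) w - W1 (t i) w, W2 (t i.+1) w - W2 (t i) w)) }.

(* The infimum of the empty set is +oo: no absorption. *)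
Definition absorption_time (R : realType) (z1 z2 : R -> R) : \bar R :=
  ereal_inf [set t%:E | t in [set t : R | [/\ 0 < t, z1 t = 0 & z2 t = 0]]].

Definition increases_only_at_zeros_of (R : realType) (l z : R -> R) :=
  forall s t : R, 0 <= s -> s <= t -> l s < l t ->
  exists2 x, s <= x <= t & z x = 0.

Definition regulator (R : realType) (l z : R -> R) :=
  [/\ l 0 = 0, continuous_path l,
      (forall s t : R, 0 <= s -> s <= t -> l s <= l t) &
      increases_only_at_zeros_of l z].

Definition reflection_equations (R : realType)
    (mu1 mu2 r1 r2 u v : R) (w1 w2 l1 l2 z1 z2 : R -> R) (t : R) :=
  [/\ z1 t = u + w1 t + mu1 * t + l1 t - r2 * l2 t, 0 <= z1 t,
      z2 t = v + w2 t + mu2 * t - r1 * l1 t + l2 t & 0 <= z2 t].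

(* Since Z(T) = (0, 0) when T < +oo, the absorption clause is required at
   t = T as well; asking it only for t > T would also allow paths that jump to
   the origin at an arbitrary time. *)
Record absorbed_reflected_BM d (T : measurableType d) (R : realType)
    (P : probability T R) (mu1 mu2 rho r1 r2 u v : R)
    (W1 W2 l1 l2 Z1 Z2 : R -> {RV P >-> R}) : Prop := {
  reflected_BM_noise : planar_BM rho W1 W2 ;
  reflected_BM_regulators : forall w,
    regulator (l1 ^~ w) (Z1 ^~ w) /\ regulator (l2 ^~ w) (Z2 ^~ w) ;
  reflected_BM_before : forall w (t : R), 0 <= t ->
    (t%:E <= absorption_time (Z1 ^~ w) (Z2 ^~ w))%E ->
    reflection_equations mu1 mu2 r1 r2 u v
      (W1 ^~ w) (W2 ^~ w) (l1 ^~ w) (l2 ^~ w) (Z1 ^~ w) (Z2 ^~ w) t ;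
  reflected_BM_after : forall w (t : R), 0 <= t ->
    (absorption_time (Z1 ^~ w) (Z2 ^~ w) <= t%:E)%E ->
    Z1 t w = 0 /\ Z2 t w = 0 }.

Definition enorm2 (R : realType) (x y : R) : R := Num.sqrt (x ^+ 2 + y ^+ 2).

Definition tends_to_infinity (R : realType) (z1 z2 : R -> R) :=
  enorm2 (z1 t) (z2 t) @[t --> +oo] --> +oo.

Definition liminf_norm (R : realType) (z1 z2 : R -> R) : \bar R :=
  limf_einf (fun t : R => (enorm2 (z1 t) (z2 t))%:E) (pinfty_nbhs R).

(* Meaningful only when P B != 0; it is 0 otherwise. *)
Definition cond_prob d (T : measurableType d) (R : realType)
    (P : probability T R) (A B : set T) : R :=
  fine (P (A `&` B)) / fine (P B).

(* Main.v *)
Require Import Defs.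
From mathcomp Require Import measurable_realfun lra ring.

(** Write X_i(t) for the free motion (start, plus W_i(t), plus mu_i t), and let
    B = X_1 + r_2 X_2 and Y = Z_1 + r_2 Z_2.  On the event of survival,
    Y = B - (r_1 r_2 - 1) l_1 with l_1 nondecreasing and r_1 r_2 >= 1, so Y never
    grows faster than B.  As Y >= 0, whenever Y(t) < C the process B cannot lose
    C during [t, t + 1]; but such a loss has a probability p > 0, independently
    of the past of t.  If the norm of Z does not tend to infinity, then for some
    C there are infinitely many times, one unit apart, at which Y < C, and the
    first i of them must all escape the loss.  This has probability at most
    (1 - p)^i, for every i.

    For the independence, Y(t) must be a function of the noise up to time t,
    although the regulators are not assumed to be adapted.  Away from the
    origin only one regulator can move at a time, and this forces (l_1, l_2) to
    be the smallest solution of the two coupled Skorokhod equations.  Unrolling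
    these equations, l_1(t) is the supremum of the sums
    r_2 (r_1 (...) - X_2(s_2)) - X_1(s_1) over finite chains t >= s_1 >= s_2 ...
    of dyadic times (push_le and reflected_path_attained).  So a visit Y(t) < C
    at a dyadic time is witnessed by finitely many values of the noise up to
    t, hence seen on the grid of mesh 2^-N for all large N.  On one grid the bound
    (1 - p)^i is a statement about a sequence of independent increments
    (spaced_visits_nodrop_le, with total_drop_conditional for the value of p),
    and it passes to the limit in N by Fatou's lemma (liminf_probability_le).

    This argument needs Z to avoid the origin at time 0 too.  When the starting
    point is the origin, survival is itself a null event: it would keep B, a
    Brownian motion with drift started at 0, nonnegative
    (nonneg_combination_null).

    The probability space is not assumed complete, so the events at stake have
    to be shown measurable: survival means that Z(n) is not the origin for
    every integer n >= 1, and by continuity of the paths recurrence can be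
    read off the dyadic times. *)

Set Implicit Arguments.
Unset Strict Implicit.
Unset Printing Implicit Defensive.

Local Open Scope classical_set_scope.
Local Open Scope ring_scope.

(** * Continuous paths *)

Lemma continuous_path_near (R : realType) (f : R -> R) (t e : R) :
  continuous_path f -> 0 <= t -> 0 < e ->
  exists2 h : R, 0 < h & forall s, 0 <= s -> `|t - s| < h -> `|f t - f s| < e.
Proof.
move=> /subspace_continuousP cf t0 e0.
have /cf : `[0, +oo[%classic t by rewrite /= in_itv /= t0.
move=> /cvgrPdist_lt /(_ _ e0).
move=> /nbhs_ballP[h /= h0 H].
exists h => // s s0 ts; apply: H => //=.
by rewrite in_itv /= s0.
Qed.

Lemma affine_path_continuous (R : realType) (f : R -> R) (a b : R) :
  continuous_path f -> continuous_path (fun t => a + f t + b * t).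
Proof.
move=> cf; apply: within_continuousD.
  by apply: within_continuousD => //; apply: continuous_subspaceT; exact: cst_continuous.
apply: continuous_subspaceT => t; exact: mulrl_continuous.
Qed.

(** Real induction: the infimum of the counterexamples could be neither
    included nor passed. *)
Lemma real_induction (R : realType) (Q : R -> Prop) :
  (forall t, 0 <= t -> (forall s, 0 <= s -> s < t -> Q s) ->
     exists2 e : R, 0 < e & forall s, t <= s -> s < t + e -> Q s) ->
  forall t, 0 <= t -> Q t.
Proof.
move=> step t t0; apply: contrapT => nQt.
pose bad := [set s : R | 0 <= s /\ ~ Q s].
have badn0 : bad !=set0 by exists t.
have bad_lb : lbound bad 0 by move=> s [].
have inf_ge0 : 0 <= inf bad by exact: lb_le_inf.
have [|e e0 He] := step _ inf_ge0.
  move=> s s0 s_lt; apply: contrapT => nQs.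
  suff : inf bad <= s by rewrite leNgt s_lt.
  by apply: ge_inf => //; exists 0.
suff : inf bad + e <= inf bad by lra.
apply: lb_le_inf => // s [s0 nQs]; rewrite leNgt; apply/negP => s_lt.
have inf_le : inf bad <= s by apply: ge_inf => //; exists 0.
exact/nQs/He.
Qed.

(** * Dyadic grids *)
Definition grid (R : realType) (N i : nat) : R := i%:R / 2 ^+ N.

Section Grid.
Context (R : realType).
Implicit Types (N k i j : nat).
Local Notation grid := (@grid R).

Lemma grid_ge0 N i : 0 <= grid N i.
Proof. by rewrite divr_ge0// exprn_ge0. Qed.

Lemma ler_grid N i j : (grid N i <= grid N j) = (i <= j)%N.
Proof. by rewrite ler_pM2r ?ler_nat// invr_gt0 exprn_gt0. Qed.

Lemma grid_refine N k i : grid N i = grid (N + k) (i * 2 ^ k).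
Proof.
rewrite /grid exprD natrM natrX invfM.
by rewrite mulrACA [_ ^+ k / _]divff ?mulr1// expf_neq0// pnatr_eq0.
Qed.

Lemma grid_add1 N i : grid N (i + 2 ^ N) = grid N i + 1.
Proof. by rewrite /grid natrD mulrDl natrX divff// expf_neq0// pnatr_eq0. Qed.

Lemma grid_dense (a b : R) : 0 <= a -> a < b ->
  exists N i, a < grid N i <= b.
Proof.
move=> a0 ab; have ba0 : 0 < (b - a)^-1 by rewrite invr_gt0 subr_gt0.
pose N := Num.bound (b - a)^-1.
have HN : (b - a)^-1 < 2 ^+ N.
  apply: lt_trans (archi_boundP (ltW ba0)) _.
  by rewrite -natrX ltr_nat ltn_expl.
have p0 : 0 < 2 ^+ N :> R by rewrite exprn_gt0.
have b0 : 0 <= b * 2 ^+ N by rewrite mulr_ge0// ltW// (le_lt_trans a0).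
exists N, (Num.truncn (b * 2 ^+ N)).
have /andP[tr1 tr2] := Num.Theory.truncn_itv b0.
rewrite /grid ltr_pdivlMr// ler_pdivrMr// tr1 andbT.
move: tr2; rewrite -natr1 => tr2.
have : 1 < (b - a) * 2 ^+ N.
  by rewrite -ltr_pdivrMl ?subr_gt0// mulr1.
by rewrite mulrBl; lra.
Qed.

Lemma path_ge_weaken (t t' : R) s : t <= t' -> path >=%R t s -> path >=%R t' s.
Proof. by case: s => //= a s tt' /andP[at_ ->]; rewrite andbT (le_trans at_). Qed.

End Grid.

(** * Reflected paths as functions of their input *)

(** Nonnegativity of the first coordinate at time a gives the lower bound
    l1 a >= r2 * l2 a - x1 a, where l2 a can in turn be bounded below at an
    earlier time by the second coordinate.  The sum [push x1 x2 r1 r2 s] is the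
    lower bound on l1 produced by doing so along the decreasing chain s. *)
Fixpoint push (R : realType) (x1 x2 : R -> R) (r1 r2 : R) (s : seq R) : R :=
  if s is a :: s' then r2 * push x2 x1 r2 r1 s' - x1 a else 0.

(** The Skorokhod equations with the signs arranged so that exchanging the two
    coordinates is a symmetry (lemma [reflected_path_sym]); most arguments are
    then made for one coordinate only. *)
Record reflected_path (R : realType) (r1 r2 : R) (x1 x2 l1 l2 : R -> R) : Prop := {
  reflected_input : continuous_path x1 /\ continuous_path x2 ;
  reflected_ge0 : forall t, 0 <= t ->
    0 <= x1 t + l1 t - r2 * l2 t /\ 0 <= x2 t + l2 t - r1 * l1 t ;
  reflected_reg1 : regulator l1 (fun t => x1 t + l1 t - r2 * l2 t) ;
  reflected_reg2 : regulator l2 (fun t => x2 t + l2 t - r1 * l1 t) }.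

Lemma reflected_path_sym (R : realType) (r1 r2 : R) (x1 x2 l1 l2 : R -> R) :
  reflected_path r1 r2 x1 x2 l1 l2 -> reflected_path r2 r1 x2 x1 l2 l1.
Proof.
case=> -[cx1 cx2] ge0 reg1 reg2; split=> // t /ge0[]; by split.
Qed.

Lemma push_le (R : realType) (r1 r2 : R) (x1 x2 l1 l2 : R -> R) (t : R) s :
  0 <= r1 -> 0 <= r2 -> 0 <= t -> {in s, forall a, 0 <= a} ->
  reflected_path r1 r2 x1 x2 l1 l2 ->
  path >=%R t s -> push x1 x2 r1 r2 s <= l1 t.
Proof.
elim: s r1 r2 x1 x2 l1 l2 t => /= [|a s IH] r1 r2 x1 x2 l1 l2 t r10 r20 t0 s0 H.
  by move=> _; have [l10 _ mono _] := reflected_reg1 H; rewrite -l10 mono.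
move=> /andP[at_ ps].
have a0 : 0 <= a by apply: s0; rewrite mem_head.
have [z1 _] := reflected_ge0 H a0.
have : push x2 x1 r2 r1 s <= l2 a.
  apply: (IH _ _ _ _ _ l1) => //; last exact: reflected_path_sym.
  by move=> b bs; apply: s0; rewrite in_cons bs orbT.
move=> /(ler_wpM2l r20) IHa.
have [_ _ mono _] := reflected_reg1 H.
by have := mono _ _ a0 at_; lra.
Qed.

Lemma reflected_path_cont (R : realType) (r1 r2 : R) (x1 x2 l1 l2 : R -> R) :
  reflected_path r1 r2 x1 x2 l1 l2 ->
  continuous_path (fun t => x1 t + l1 t - r2 * l2 t).
Proof.
move=> [[cx1 _] _ [_ cl1 _ _] [_ cl2 _ _]].
apply: (@within_continuousB _ _ _ _ (fun t => x1 t + l1 t)).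
  exact: within_continuousD.
by move=> t; apply: cvgM; [exact: cvg_cst|exact: cl2].
Qed.

(** Here [l1 t] is approached by the lower bounds of chains of grid times, which
    makes it a function of [x1] and [x2] up to time t. *)
Definition attained (R : realType) (x1 x2 l1 : R -> R) (r1 r2 t : R) :=
  forall e, 0 < e -> exists N s, path >=%R t (map (@grid R N) s) /\
    l1 t - e < push x1 x2 r1 r2 (map (@grid R N) s).

(** While the first coordinate stays positive, l1 is frozen at its value at
    time t, which chains approach already.  The other regulator is then driven
    by a known path: if l2 has grown, it was pushed at a time x where the
    second coordinate vanishes, that is l2 x = r1 * l1 t - x2 x, and one more
    grid time just before x, put in front of a chain for l1, reproduces that
    value. *)
Lemma attained_after (R : realType) (r1 r2 : R) (x1 x2 l1 l2 : R -> R) (t : R) :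
  0 < r1 -> 0 < r2 -> 0 <= t ->
  reflected_path r1 r2 x1 x2 l1 l2 ->
  attained x1 x2 l1 r1 r2 t -> attained x2 x1 l2 r2 r1 t ->
  0 < x1 t + l1 t - r2 * l2 t ->
  exists2 h, 0 < h & forall t', t <= t' -> t' < t + h ->
    attained x1 x2 l1 r1 r2 t' /\ attained x2 x1 l2 r2 r1 t'.
Proof.
move=> r10 r20 t0 H at1 at2 z1t.
have [h h0 Hh] := continuous_path_near (reflected_path_cont H) t0 z1t.
have [_ _ mono1 inc1] := reflected_reg1 H.
have [_ cl2 mono2 inc2] := reflected_reg2 H.
have l1cst t' : t <= t' -> t' < t + h -> l1 t' = l1 t.
  move=> tt' t'h; apply/eqP; rewrite eq_le [X in _ && X]mono1// andbT leNgt; apply/negP.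
  move=> /(inc1 _ _ t0 tt')[x /andP[tx xt'] zx].
  have := Hh x (le_trans t0 tx).
  have xtE : `|t - x| < h by rewrite ltr_norml; apply/andP; split; lra.
  by move=> /(_ xtE); rewrite zx subr0 gtr0_norm// ltxx.
exists h => // t' tt' t'h; split.
  move=> e /at1[N [s [ps Hs]]]; exists N, s; split.
    exact: path_ge_weaken ps.
  by rewrite l1cst.
move=> e e0.
have [l2le|l2gt] := leP (l2 t') (l2 t + e / 2).
  have [|N [s [ps Hs]]] := at2 (e / 2); first by lra.
  by exists N, s; split; [exact: path_ge_weaken ps|lra].
(* A level below l2 t', so that the regulator still grows after y, but high
   enough for the push found in [y, t'] to lose at most e / 2. *)
have : exists2 y, y \in `[t, t'] & l2 y = l2 t' - e / 2.
  apply: IVT => //.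
    apply: continuous_subspaceW cl2 => y /=.
    by rewrite !in_itv /= => /andP[ty _]; rewrite andbT (le_trans t0).
  by have := mono2 _ _ t0 tt' => l2tt'; rewrite min_l// max_r//; apply/andP; split; lra.
move=> [y]; rewrite in_itv /= => /andP[ty yt'] l2y.
have y0 : 0 <= y by lra.
have [|x /andP[yx xt'] zx] := inc2 y t' y0 yt'; first by lra.
have x0 : 0 <= x by lra.
have l2x := mono2 _ _ y0 yx.
have tx : t < x.
  by rewrite ltNge; apply/negP => xt; have := mono2 _ _ x0 xt; lra.
have [_ cx2] := reflected_input H.
have [|h' h'0 Hh'] := @continuous_path_near _ _ x (e / 8) cx2 x0; first by lra.
have [||N1 [i /andP[Hi1 Hi2]]] := @grid_dense _ (Num.max t (x - h')) x.
- by rewrite le_max t0.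
- by rewrite gt_max tx /=; lra.
move: Hi1; rewrite gt_max => /andP[ti xi].
have [|N2 [s [ps Hs]]] := at1 (e / (8 * r1)).
  by rewrite divr_gt0// mulr_gt0.
exists (N2 + N1)%N, (i * 2 ^ N2 :: map (muln^~ (2 ^ N1)%N) s)%N => /=.
have -> : map (grid R (N2 + N1)) (map (muln^~ (2 ^ N1)%N) s) = map (grid R N2) s.
  by rewrite -map_comp; apply: eq_map => k /=; rewrite [in RHS](grid_refine _ _ N1).
rewrite addnC -grid_refine; split.
  by rewrite (le_trans Hi2 xt') /=; apply: path_ge_weaken ps; exact: ltW.
have : `|x2 x - x2 (grid R N1 i)| < e / 8.
  by apply: Hh'; [exact: grid_ge0|rewrite ltr_norml; apply/andP; split; lra].
rewrite ltr_norml => /andP[Hx2 _].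
have l1x : l1 x = l1 t by apply: l1cst; lra.
move: zx; rewrite l1x => zx.
have : r1 * (l1 t - e / (8 * r1)) < r1 * push x1 x2 r1 r2 (map (grid R N2) s).
  by rewrite ltr_pM2l.
have -> : r1 * (l1 t - e / (8 * r1)) = r1 * l1 t - e / 8.
  by field; rewrite gt_eqF.
by lra.
Qed.

Lemma attained_left (R : realType) (r1 r2 : R) (x1 x2 l1 : R -> R) (t : R) :
  0 < t -> continuous_path l1 ->
  (forall s, 0 <= s -> s < t -> attained x1 x2 l1 r1 r2 s) ->
  attained x1 x2 l1 r1 r2 t.
Proof.
move=> t0 cl1 H e e0.
have [|h h0 Hh] := @continuous_path_near _ _ t (e / 2) cl1 (ltW t0); first by lra.
pose s := Num.max 0 (t - h / 2).
have s0 : 0 <= s by rewrite /s le_max lexx.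
have st : s < t by rewrite /s gt_max t0 /=; lra.
have sh : t - h / 2 <= s by rewrite /s le_max lexx orbT.
have [|N [c [pc Hc]]] := H s s0 st (e / 2); first by lra.
exists N, c; split; first exact: path_ge_weaken (ltW st) pc.
have : `|l1 t - l1 s| < e / 2.
  by apply: Hh => //; rewrite ltr_norml; apply/andP; split; lra.
by rewrite ltr_norml => /andP[_]; lra.
Qed.

(** The property propagates: it passes to left limits because the regulators
    are continuous, and it continues to the right because at each time some
    coordinate is positive.  This is where avoiding the origin matters: from the
    corner, both regulators could grow together and the equations would have
    other solutions than the smallest one. *)
Lemma reflected_path_attained (R : realType) (r1 r2 : R) (x1 x2 l1 l2 : R -> R) :
  0 < r1 -> 0 < r2 -> reflected_path r1 r2 x1 x2 l1 l2 ->
  (forall t, 0 <= t -> ~ (x1 t + l1 t - r2 * l2 t = 0 /\ x2 t + l2 t - r1 * l1 t = 0)) ->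
  forall t, 0 <= t -> attained x1 x2 l1 r1 r2 t /\ attained x2 x1 l2 r2 r1 t.
Proof.
move=> r10 r20 H zN0; apply: real_induction => t t0 IH.
have [l10 cl1 _ _] := reflected_reg1 H.
have [l20 cl2 _ _] := reflected_reg2 H.
have [at1 at2] : attained x1 x2 l1 r1 r2 t /\ attained x2 x1 l2 r2 r1 t.
  have [->|tn0] := eqVneq t 0.
    by split=> e e0; exists 0%N, [::]; split=> //=; lra.
  have tgt0 : 0 < t by rewrite lt_neqAle eq_sym tn0.
  by split; apply: attained_left => // s s0 st; case: (IH s s0 st).
have [z1 z2] := reflected_ge0 H t0.
have [z1gt|z1le] := ltP 0 (x1 t + l1 t - r2 * l2 t).
  exact: attained_after z1gt.
have z2gt : 0 < x2 t + l2 t - r1 * l1 t.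
  rewrite lt_neqAle z2 andbT; apply/eqP => z2E; apply: (zN0 t t0); split => //.
  by apply/eqP; rewrite eq_le z1le.
have [h h0 Hh] := attained_after r20 r10 t0 (reflected_path_sym H) at2 at1 z2gt.
by exists h => // s ts sh; have [] := Hh s ts sh.
Qed.

(** * Tails of centered normal laws *)

Lemma normal_peakM (R : realType) (c s : R) : 0 < c -> 0 < s ->
  normal_peak (c * s) = c^-1 * normal_peak s.
Proof.
move=> c0 s0; rewrite /normal_peak exprMn -mulrA -mulrnAr sqrtrM ?sqr_ge0//.
by rewrite sqrtr_sqr gtr0_norm// invfM -mulrnAr.
Qed.

(** The density on the interval from -(K + 1) s to -K s is at least its value at
    -(K + 1) s, which is proportional to 1 / s; the bound is thus uniform in the
    scale s. *)
Lemma normal_prob_lower_tail (R : realType) (K s x : R) :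
  0 <= K -> 0 < s -> x <= K * s ->
  ((normal_peak 1 * expR (- (K + 1) ^+ 2 / 2))%:E <=
   normal_prob 0 s `]-oo, (- x)%R[)%E.
Proof.
move=> K0 s0 xK; have sn0 : s != 0 by rewrite gt_eqF.
set c := expR _.
pose I : set R := `]- ((K + 1) * s), - (K * s)[%classic.
have mI : measurable I by exact: measurable_itv.
have mpdf (D : set R) : measurable_fun D (normal_pdf 0 s).
  by apply: measurable_funTS; exact: measurable_normal_pdf.
apply: (@le_trans _ _ (\int[lebesgue_measure]_(y in I)
    (normal_peak s * c)%:E)%E).
  rewrite integral_cst//= lebesgue_measure_itv/= lte_fin.
  have -> : - ((K + 1) * s) < - (K * s) by rewrite mulrDl; lra.
  rewrite -EFinB -EFinM lee_fin -[X in normal_peak X](mulVf sn0).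
  rewrite normal_peakM ?invr_gt0// invrK.
  by rewrite le_eqVlt; apply/orP; left; apply/eqP; ring.
apply: (@le_trans _ _ (normal_prob 0 s I)).
  apply: ge0_le_integral => //.
  - by move=> y _; rewrite lee_fin mulr_ge0 ?normal_peak_ge0 ?expR_ge0.
  - by apply/measurable_EFinP; exact: mpdf.
  move=> y; rewrite /I /= in_itv /= => /andP[y1 y2]; rewrite lee_fin normal_pdfE//.
    rewrite ler_wpM2l ?normal_peak_ge0// ler_expR subr0 !mulNr lerN2.
    rewrite -mulr_natr invfM mulrA ler_pM2r ?invr_gt0//.
    rewrite ler_pdivrMr ?exprn_gt0// -exprMn.
    by rewrite -sqrrN ler_sqr ?nnegrE; nra.
apply: le_measure; rewrite ?inE//.
by move=> y /=; rewrite !in_itv /= => /andP[_ yK]; apply: lt_le_trans yK _; rewrite lerN2.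
Qed.

(** A tail bound of Chebyshev type.  Beyond x, the density at scale s is at most
    6 s^2 / x^2 times the density at scale 2 s, whose total mass is 1; no moment
    has to be computed. *)
Lemma normal_prob_upper_tail (R : realType) (s x : R) : 0 < s -> 0 < x ->
  (normal_prob 0 s `]x, +oo[ <= (6 * s ^+ 2 / x ^+ 2)%:E)%E.
Proof.
move=> s0 x0; have sn0 : s != 0 by rewrite gt_eqF.
have s2n0 : 2 * s != 0 by rewrite mulf_neq0.
have mpdf t (D : set R) : measurable_fun D (normal_pdf 0 t).
  by apply: measurable_funTS; exact: measurable_normal_pdf.
set c := _ / _.
pose I : set R := `]x, +oo[%classic.
have mI : measurable I by exact: measurable_itv.
have c0 : 0 <= c by rewrite divr_ge0 ?sqr_ge0// mulr_ge0 ?sqr_ge0.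
apply: (@le_trans _ _ (\int[lebesgue_measure]_(y in I)
    (c%:E * (normal_pdf 0 (2 * s) y)%:E))%E).
  apply: ge0_le_integral => //.
  - by move=> y _; rewrite lee_fin normal_pdf_ge0.
  - by apply/measurable_EFinP; exact: mpdf.
  - by apply: measurable_funeM; apply/measurable_EFinP; exact: mpdf.
  move=> y; rewrite /I /= in_itv /= andbT => xy; have y0 := lt_trans x0 xy.
  rewrite -EFinM lee_fin !normal_pdfE//= /normal_fun normal_peakM// !subr0.
  pose w := y ^+ 2 / (8 * s ^+ 2).
  have -> : - (y ^+ 2) / (s ^+ 2 *+ 2) = - (3 * w) - w by rewrite /w; field.
  have -> : - (y ^+ 2) / ((2 * s) ^+ 2 *+ 2) = - w.
    by rewrite /w exprMn; field.
  have w0 : 0 < w by rewrite divr_gt0 ?exprn_gt0// pmulr_rgt0 ?exprn_gt0.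
  (* expR (3 w) >= 3 w trades the Gaussian weight at scale s for the one at
     scale 2 s, at the cost of the factor 1 / (3 w). *)
  have exp3w : expR (- (3 * w)) <= (3 * w)^-1.
    have w3 : 0 < 3 * w by rewrite pmulr_rgt0.
    rewrite expRN lef_pV2 ?posrE ?expR_gt0//.
    by apply: le_trans (expR_ge1Dx _); lra.
  have wx : (3 * w)^-1 <= c / 2.
    have -> : (3 * w)^-1 = 8 / 3 * s ^+ 2 / y ^+ 2.
      by rewrite /w; field; rewrite sn0 gt_eqF.
    have -> : c / 2 = 3 * s ^+ 2 / x ^+ 2 by rewrite /c; field; rewrite gt_eqF.
    apply: ler_pM.
    - by rewrite pmulr_rge0 ?sqr_ge0.
    - by rewrite invr_ge0 sqr_ge0.
    - by rewrite ler_pM2r ?exprn_gt0//; lra.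
    - by rewrite lef_pV2 ?posrE ?exprn_gt0// ler_sqr ?nnegrE; lra.
  rewrite [leRHS](_ : _ = normal_peak s * (c / 2) * expR (- w)); last by field.
  rewrite expRD [leLHS]mulrA ler_pM2r ?expR_gt0// ler_wpM2l ?normal_peak_ge0//.
  exact: le_trans exp3w wx.
rewrite ge0_integralZl//; last 2 first.
- by apply/measurable_EFinP; exact: mpdf.
- by move=> y _; rewrite lee_fin; exact: normal_pdf_ge0.
rewrite -[leRHS]mule1; apply: lee_wpmul2l; first by rewrite lee_fin.
exact: (@probability_le1 _ _ _ (normal_prob 0 (2 * s))).
Qed.

(** * Repeated visits without a drop *)

Fixpoint spaced_visits (T : Type) (A : nat -> set T) (m i j : nat) : set T :=
  if i is i'.+1 then
    \bigcup_k (A (j + k)%N `&` spaced_visits A m i' (j + k + m)%N)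
  else setT.

Section SpacedVisits.
Context d (T : measurableType d) (R : realType) (P : probability T R).
Context (G : nat -> set (set T)) (A D : nat -> set T) (m : nat) (q : R).
Hypothesis G_measurable : forall j, <<s G j >> `<=` measurable.
Hypothesis G_nondecreasing : forall j k, (j <= k)%N -> <<s G j >> `<=` <<s G k >>.
Hypothesis A_adapted : forall j, <<s G j >> (A j).
Hypothesis D_adapted : forall j, <<s G (j + m)%N >> (D j).
Hypothesis q_ge0 : 0 <= q.
Hypothesis D_conditional : forall j E, <<s G j >> E ->
  (P (E `&` ~` D j) <= q%:E * P E)%E.

Lemma measurable_spaced_visits i j : measurable (spaced_visits A m i j).
Proof.
elim: i j => [|i IH] j /=; first exact: measurableT.
apply: bigcupT_measurable => k; apply: measurableI; last exact: IH.
exact: G_measurable (A_adapted _).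
Qed.

Lemma spaced_visits_le (i j k : nat) : (j <= k)%N ->
  spaced_visits A m i k `<=` spaced_visits A m i j.
Proof.
case: i => //= i jk w [l _ [Aw Vw]]; exists (k - j + l)%N => //.
by rewrite addnA subnKC.
Qed.

(** Induction on i, splitting according to the first visit after time j.  Given
    the past of that visit, the drop fails with probability at most q, and
    whether it fails is known m steps later, before the next of the visits that
    are counted. *)
Lemma spaced_visits_nodrop_le (i j : nat) (E : set T) : <<s G j >> E ->
  (P (E `&` spaced_visits A m i j `&` \bigcap_k ~` (A k `&` D k))
   <= (q ^+ i)%:E * P E)%E.
Proof.
set N := \bigcap_k _.
have mA k : measurable (A k) by exact: G_measurable (A_adapted _).
have mD k : measurable (D k) by exact: G_measurable (D_adapted _).
have mN : measurable N.
  by apply: bigcapT_measurable => k; apply/measurableC/measurableI.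
elim: i j E => [|i IH] j E GE; have mE := G_measurable GE.
  rewrite expr0 mul1e; apply: le_measure; rewrite ?inE.
  - by apply: measurableI => //; apply: measurableI => //; exact: measurableT.
  - exact: mE.
  - by move=> w [[]].
pose B := seqDU (fun k => A (j + k)%N).
have GEB k : <<s G (j + k)%N >> (E `&` B k).
  apply: (@measurableI _ (g_sigma_algebraType (G (j + k)%N))).
    exact: (G_nondecreasing (leq_addr _ _)).
  apply: (@measurableD _ (g_sigma_algebraType (G (j + k)%N))).
    exact: A_adapted.
  rewrite -(bigcup_mkord k (fun l => A (j + l)%N)).
  apply: (@bigcup_measurable _ (g_sigma_algebraType (G (j + k)%N))) => l /= lk.
  by apply: (@G_nondecreasing (j + l)); [rewrite leq_add2l ltnW|exact: A_adapted].
have GH k : <<s G (j + k + m)%N >> (E `&` B k `&` ~` D (j + k)%N).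
  apply: (@measurableI _ (g_sigma_algebraType (G (j + k + m)%N))).
    exact: (G_nondecreasing (leq_addr _ _) (GEB k)).
  apply: (@measurableC _ (g_sigma_algebraType (G (j + k + m)%N))).
  exact: D_adapted.
pose X k := E `&` B k `&` ~` D (j + k)%N `&` spaced_visits A m i (j + k + m) `&` N.
have mX k : measurable (X k).
  apply: measurableI => //; apply: measurableI; first exact: G_measurable (GH k).
  exact: measurable_spaced_visits.
apply: (@le_trans _ _ (P (\bigcup_k X k))).
  apply: le_measure; rewrite ?inE.
  - apply: measurableI => //; apply: measurableI => //.
    exact: measurable_spaced_visits.
  - exact: bigcupT_measurable.
  move=> w [[Ew [k _ [Ak Vk]]] Nw].
  have : (\bigcup_l A (j + l)%N) w by exists k.
  rewrite seqDU_bigcup_eq => -[l _ Bl]; exists l => //.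
  have lk : (l <= k)%N.
    rewrite leqNgt; apply/negP => kl; case: Bl => _; apply.
    by rewrite -(bigcup_mkord l (fun l => A (j + l)%N)); exists k.
  split=> //; split; last by apply: spaced_visits_le Vk; rewrite leq_add2r leq_add2l.
  split=> // Dl; apply: (Nw (j + l)%N) => //; split=> //.
  exact: subset_seqDU Bl.
apply: (@le_trans _ _ (\sum_(0 <= k <oo) P (X k))%E).
  by apply: measure_sigma_subadditive => //; exact: bigcupT_measurable.
apply: (@le_trans _ _ (\sum_(0 <= k <oo) ((q ^+ i.+1)%:E * P (E `&` B k)))%E).
  apply: lee_nneseries => k _ //; apply: le_trans (IH _ _ (GH k)) _.
  rewrite exprSr EFinM -muleA lee_wpmul2l ?lee_fin ?exprn_ge0//.
  exact: D_conditional.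
rewrite nneseriesZl//; apply: lee_wpmul2l; first by rewrite lee_fin exprn_ge0.
have -> : (\sum_(0 <= k <oo) P (E `&` B k) = P (\bigcup_k (E `&` B k)))%E.
  rewrite measure_bigcup.
  - by apply: eq_eseriesl => k; rewrite in_setT.
  - by move=> k _; exact: G_measurable (GEB k).
  - exact/trivIset_setIl/trivIset_seqDU.
apply: le_measure; rewrite ?inE//.
- by apply: bigcupT_measurable => k; exact: G_measurable (GEB k).
- by move=> w [k _ []].
Qed.

End SpacedVisits.

(** * The past of a planar Brownian motion on a sequence of times *)

(** Dynkin's lemma: the events independent of D form a lambda-system. *)
Lemma independent_g_sigma_algebra d (T : measurableType d) (R : realType)
    (P : probability T R) (G : set (set T)) (D : set T) :
  setI_closed G -> G `<=` measurable -> measurable D ->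
  (forall E, G E -> P (E `&` D) = (P E * P D)%E) ->
  forall E, <<s G >> E -> measurable E /\ P (E `&` D) = (P E * P D)%E.
Proof.
move=> GI Gm mD GD.
pose H := [set E | measurable E /\ P (E `&` D) = (P E * P D)%E].
suff : <<s G >> `<=` H by [].
have fP (E : set T) : measurable E -> P E \is a fin_num by move=> mE; exact: fin_num_measure.
apply: lambda_system_subset => //.
  apply/dynkin_lambda_system; split=> /=.
  - by split; [exact: measurableT|rewrite setTI probability_setT mul1e].
  - move=> E [mE PE]; split; first exact: measurableC.
    rewrite setIC -setDE measureD//; last first.
      by rewrite ltey_eq fP.
    transitivity (P D - P E * P D)%E; first by rewrite -PE [E `&` D]setIC.
    rewrite probability_setC//.
    by rewrite muleBl ?mul1e ?fP// fin_num_adde_defl// fP.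
  move=> F tF HF; have mF k : measurable (F k) by have [] := HF k.
  split; first exact: bigcupT_measurable.
  rewrite setI_bigcupl !measure_bigcup//; last 2 first.
  - by move=> k _; exact: measurableI.
  - exact: trivIset_setIr.
  rewrite muleC -(fineK (fP _ mD)) -nneseriesZl//; apply: eq_eseriesr => k _.
  have [_ PFk] := HF k; apply: (eq_trans PFk).
  by rewrite muleC fineK// fP.
by move=> E GE; split; [exact: Gm|exact: GD].
Qed.

Section Filtration.
Context d (T : measurableType d) (R : realType) (P : probability T R).
Context (rho : R) (W1 W2 : R -> {RV P >-> R}).
Hypothesis BM : planar_BM rho W1 W2.

Definition increment (s t : R) (w : T) : R * R :=
  (W1 t w - W1 s w, W2 t w - W2 s w).

(** The events that constrain each of the first n increments separately.  They
    form a pi-system, on which independence of increments is a product rule, and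
    they generate all that the increments reveal up to time t n. *)
Definition increment_rectangles (t : nat -> R) (n : nat) : set (set T) :=
  [set E | exists2 A : nat -> set (R * R), (forall i, measurable (A i)) &
    E = \bigcap_(i < n) (increment (t i) (t i.+1) @^-1` A i)].

Lemma measurable_increment s t : measurable_fun setT (increment s t).
Proof.
by apply/measurable_fun_pair; apply: measurable_funB.
Qed.

Lemma increment_rectangles_measurable t n :
  increment_rectangles t n `<=` measurable.
Proof.
move=> _ [A mA ->]; apply: bigcap_measurableType => i _.
rewrite -[X in measurable X]setTI; exact: measurable_increment.
Qed.

Lemma increment_rectangles_setI_closed t n : setI_closed (increment_rectangles t n).
Proof.
move=> _ _ [A mA ->] [B mB ->]; exists (fun i => A i `&` B i).
  by move=> i; exact: measurableI.
by rewrite -bigcapI.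
Qed.

Lemma increment_rectangles_nondecreasing t m n : (m <= n)%N ->
  <<s increment_rectangles t m >> `<=` <<s increment_rectangles t n >>.
Proof.
move=> mn; apply: smallest_sub; first exact: smallest_sigma_algebra.
move=> _ [A mA ->]; apply: sub_gen_smallest.
exists (fun i => if (i < m)%N then A i else setT).
  by move=> i; case: ifP.
apply/seteqP; split=> w Aw i /= lti; last first.
  by have := Aw i (leq_trans lti mn) => /=; rewrite lti.
by case: ifP => // im; exact: Aw.
Qed.

Lemma increment_independent t n (s : R) (V : set (R * R)) E :
  0 <= t 0%N -> {homo t : i j / (i <= j)%N >-> i <= j} -> t n <= s ->
  measurable V -> <<s increment_rectangles t n >> E ->
  measurable E /\ P (E `&` increment (t n) s @^-1` V) =
    (P E * P (increment (t n) s @^-1` V))%E.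
Proof.
move=> t0 tmono tns mV; apply: independent_g_sigma_algebra.
- exact: increment_rectangles_setI_closed.
- exact: increment_rectangles_measurable.
- rewrite -[X in measurable X]setTI; exact: measurable_increment.
move=> _ [A mA ->].
(* The same times up to t n, followed by the single time s. *)
pose t' i := if (i <= n)%N then t i else s.
have t'0 : 0 <= t' 0%N by [].
have t'mono : {homo t' : i j / (i <= j)%N >-> i <= j}.
  move=> i j ij; rewrite /t'.
  have [ni|ni] := leqP i n; have [nj|nj] := leqP j n => //.
  - exact: tmono.
  - by apply: le_trans tns; exact: tmono.
  - by move: (leq_trans ni ij); rewrite ltnNge nj.
pose A' (V' : set (R * R)) i := if (i < n)%N then A i else V'.
have rect V' : measurable V' ->
  P (\bigcap_(i < n) (increment (t i) (t i.+1) @^-1` A i) `&`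
     increment (t n) s @^-1` V') =
  ((\prod_(i < n) P (increment (t i) (t i.+1) @^-1` A i)) *
   P (increment (t n) s @^-1` V'))%E.
  move=> mV'.
  have mA' i : measurable (A' V' i) by rewrite /A'; case: ifP.
  have := planar_BM_independent BM t'0 t'mono (n := n.+1) (fun i => mA' (val i)).
  rewrite big_ord_recr /=.
  have -> : \bigcap_(i in [set: 'I_n.+1]) (fun w =>
     (W1 (t' i.+1) w - W1 (t' i) w, W2 (t' i.+1) w - W2 (t' i) w)) @^-1` A' V' i
     = \bigcap_(i < n) (increment (t i) (t i.+1) @^-1` A i) `&`
     increment (t n) s @^-1` V'.
    apply/seteqP; split=> w /=.
      move=> Hw; split.
        move=> i /= iltn; have := Hw (Ordinal (ltnW iltn : (i < n.+1)%N)) I.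
        by rewrite /= /A' /t' iltn (ltnW iltn).
      by have := Hw ord_max I; rewrite /= /A' /t' !ltnn leqnn.
    move=> [Hw1 Hw2] [i /= iltn] _ /=; rewrite /A' /t'.
    have /predU1P[ni|ni] : (i == n) || (i < n)%N by rewrite -leq_eqVlt -ltnS.
      by rewrite ni leqnn !ltnn; exact: Hw2.
    by rewrite (ltnW ni) !ni; exact: Hw1.
  move=> ->; congr (_ * _)%E.
    by apply: eq_bigr => i _; rewrite /A' /t' ltn_ord (ltnW (ltn_ord i)).
  by rewrite /A' /t' !ltnn leqnn.
(* V' = setT evaluates the probability of the rectangle alone. *)
rewrite rect//; congr (_ * _)%E.
have := rect _ measurableT; rewrite preimage_setT setIT probability_setT mule1.
by [].
Qed.

Lemma measurable_adapted t n i : t 0%N = 0 -> (i <= n)%N ->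
  measurable_fun setT (W1 (t i) : g_sigma_algebraType (increment_rectangles t n) -> R) /\
  measurable_fun setT (W2 (t i) : g_sigma_algebraType (increment_rectangles t n) -> R).
Proof.
move=> t0; elim: i => [|i IH] lein.
  have [W10 W20] : W1 0 = cst 0 :> (T -> R) /\ W2 0 = cst 0 :> (T -> R).
    by split; apply/funext => w; case: (planar_BM0 BM w).
  by rewrite t0 W10 W20; split; exact: measurable_cst.
have [m1 m2] := IH (ltnW lein).
have minc : measurable_fun setT (increment (t i) (t i.+1) :
    g_sigma_algebraType (increment_rectangles t n) -> R * R).
  move=> _ V mV; rewrite setTI; apply: sub_gen_smallest.
  exists (fun k => if k == i then V else setT); first by move=> k; case: ifP.
  apply/seteqP; split=> w /= Hw.
    by move=> k _ /=; case: eqP => // ->.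
  by have := Hw i lein; rewrite /= eqxx.
have W1E : W1 (t i.+1) = W1 (t i) \+ (fst \o increment (t i) (t i.+1)) :> (T -> R).
  by apply/funext => w /=; rewrite addrC subrK.
have W2E : W2 (t i.+1) = W2 (t i) \+ (snd \o increment (t i) (t i.+1)) :> (T -> R).
  by apply/funext => w /=; rewrite addrC subrK.
rewrite W1E W2E; split; apply: measurable_funD => //.
- by apply: measurableT_comp => //; exact: measurable_fst.
- by apply: measurableT_comp => //; exact: measurable_snd.
Qed.

End Filtration.

(** * Drops of the total motion along one grid *)

Lemma variance_gt0 (R : realType) (rho r : R) :
  -1 < rho -> 0 < r -> 0 < 1 + r ^+ 2 + 2 * r * rho.
Proof.
move=> rho1 r0; have -> : 1 + r ^+ 2 + 2 * r * rho = (1 - r) ^+ 2 + 2 * r * (1 + rho) by ring.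
by rewrite ltr_wpDl ?sqr_ge0// !mulr_gt0//; lra.
Qed.

(** Fatou's lemma for events, the limit inferior being replaced by a measurable
    subset of it. *)
Lemma liminf_probability_le d (T : measurableType d) (R : realType)
    (P : probability T R) (S : nat -> set T) (E : set T) (c : \bar R) :
  measurable E -> (forall n, measurable (S n)) -> (forall n, (P (S n) <= c)%E) ->
  (forall w, E w -> exists n0, forall n, (n0 <= n)%N -> S n w) -> (P E <= c)%E.
Proof.
move=> mE mS PS ES.
pose I n0 := \bigcap_(n in [set n | (n0 <= n)%N]) S n.
have mI n0 : measurable (I n0) by exact: bigcap_measurableType.
have mUI : measurable (\bigcup_n I n) by exact: bigcupT_measurable.
apply: (@le_trans _ _ (P (\bigcup_n I n))).
  by apply: le_measure; rewrite ?inE// => w /ES[n0 Hn0]; exists n0.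
have /cvg_lim <- // : P (I n) @[n --> \oo] --> P (\bigcup_n I n).
  apply: (@nondecreasing_cvg_mu _ _ _ P I) => // m n mn.
  by apply/subsetPset => w Iw k /= nk; apply: Iw; exact: leq_trans nk.
apply: lime_le.
  apply/cvg_ex; exists (P (\bigcup_n I n)).
  apply: (@nondecreasing_cvg_mu _ _ _ P I) => // m n mn.
  by apply/subsetPset => w Iw k /= nk; apply: Iw; exact: leq_trans nk.
apply: nearW => n; apply: le_trans (PS n).
by apply: le_measure; rewrite ?inE// => w; apply => /=.
Qed.

Lemma measurable_push d (T : measurableType d) (R : realType)
    (X1 X2 : R -> T -> R) (r1 r2 : R) (s : seq R) :
  {in s, forall a, measurable_fun setT (X1 a) /\ measurable_fun setT (X2 a)} ->
  measurable_fun setT (fun w => push (X1 ^~ w) (X2 ^~ w) r1 r2 s).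
Proof.
elim: s X1 X2 r1 r2 => [|a s IH] X1 X2 r1 r2 H /=; first exact: measurable_cst.
apply: measurable_funB; last by have [] := H a (mem_head _ _).
apply: measurable_funM; first exact: measurable_cst.
by apply: IH => b bs; have [|] := H b; rewrite ?in_cons ?bs ?orbT.
Qed.

Section Drop.
Context d (T : measurableType d) (R : realType) (P : probability T R).
Context (rho r : R) (W1 W2 : R -> {RV P >-> R}).
Hypothesis BM : planar_BM rho W1 W2.
Hypothesis rho_gtN1 : -1 < rho.
Hypothesis r_gt0 : 0 < r.
Let sigma2 := 1 + r ^+ 2 + 2 * r * rho.

Definition combination : R * R -> R := fun x => x.1 + r * x.2.

Lemma measurable_combination : measurable_fun setT combination.
Proof.
apply: measurable_funD; first exact: measurable_fst.
by apply: measurable_funM; [exact: measurable_cst|exact: measurable_snd].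
Qed.

Lemma combination_law (s t : R) (V : set R) : 0 <= s -> s < t -> measurable V ->
  P (increment W1 W2 s t @^-1` (combination @^-1` V)) =
  normal_prob 0 (Num.sqrt (sigma2 * (t - s))) V.
Proof.
move=> s0 st mV.
have pq : (1, r) != (0, 0) :> R * R by rewrite xpair_eqE oner_eq0.
have := planar_BM_gaussian BM s0 st pq mV.
have -> : 1 ^+ 2 * (t - s) + r ^+ 2 * (t - s) + 2 * 1 * r * (rho * (t - s)) =
   sigma2 * (t - s) by rewrite /sigma2; ring.
by move=> <-; congr (P _); apply/seteqP; split=> w;
  rewrite /preimage /= /combination /= mul1r.
Qed.

Lemma combination_drop (s t x K : R) : 0 <= s -> s < t -> 0 <= K ->
  x <= K * Num.sqrt (sigma2 * (t - s)) ->
  ((normal_peak 1 * expR (- (K + 1) ^+ 2 / 2))%:E <=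
   P (increment W1 W2 s t @^-1` [set y | (combination y < - x)%R]))%E.
Proof.
move=> s0 st K0 xK.
have -> : [set y | combination y < - x] = combination @^-1` `]-oo, - x[%classic.
  by apply/seteqP; split=> y /=; rewrite in_itv.
rewrite combination_law//; apply: normal_prob_lower_tail => //.
by rewrite sqrtr_gt0 mulr_gt0 ?subr_gt0//; exact: variance_gt0.
Qed.

Lemma combination_rise (s t x : R) : 0 <= s -> s < t -> 0 < x ->
  (P (increment W1 W2 s t @^-1` [set y | (x < combination y)%R]) <=
   (6 * (sigma2 * (t - s)) / x ^+ 2)%:E)%E.
Proof.
move=> s0 st x0.
have v0 : 0 < sigma2 * (t - s).
  by rewrite mulr_gt0 ?subr_gt0//; exact: variance_gt0.
have -> : [set y | x < combination y] = combination @^-1` `]x, +oo[%classic.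
  by apply/seteqP; split=> y /=; rewrite in_itv /= andbT.
rewrite combination_law//; apply: le_trans (normal_prob_upper_tail _ x0) _.
  by rewrite sqrtr_gt0.
by rewrite sqr_sqrtr// ltW.
Qed.

End Drop.

Section Level.
Context d (T : measurableType d) (R : realType) (P : probability T R).
Context (rho mu1 mu2 r1 r2 u v C : R) (W1 W2 : R -> {RV P >-> R}).
Hypothesis BM : planar_BM rho W1 W2.
Hypothesis rho_gtN1 : -1 < rho.
Hypothesis r2_gt0 : 0 < r2.

Definition input1 (t : R) (w : T) : R := u + W1 t w + mu1 * t.
Definition input2 (t : R) (w : T) : R := v + W2 t w + mu2 * t.
(** The free part of Z1 + r2 * Z2. *)
Definition input (t : R) (w : T) : R := input1 t w + r2 * input2 t w.

(** On surviving paths this entails that Z1 + r2 * Z2 is below C at the j-th grid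
    time, since l1 is replaced by its lower bound along a chain of grid times:
    it is what the noise observed on the grid can certify. *)
Definition low_visit (N j : nat) : set T :=
  [set w | exists s : seq nat, path >=%R (grid R N j) (map (grid R N) s) /\
    input (grid R N j) w - (r1 * r2 - 1) *
      push (input1 ^~ w) (input2 ^~ w) r1 r2 (map (grid R N) s) < C].

Definition total_drop (N j : nat) : set T :=
  [set w | input (grid R N j + 1) w - input (grid R N j) w < - C].

Local Notation past N j := (increment_rectangles W1 W2 (grid R N) j).

Lemma grid00 N : grid R N 0 = 0.
Proof. by rewrite /grid mul0r. Qed.

Lemma input_adapted N j i : (i <= j)%N ->
  measurable_fun setT (input1 (grid R N i) : g_sigma_algebraType (past N j) -> R) /\
  measurable_fun setT (input2 (grid R N i) : g_sigma_algebraType (past N j) -> R).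
Proof.
move=> ij; have [m1 m2] := measurable_adapted BM (grid00 N) ij.
by split; apply: measurable_funD => //; apply: measurable_funD.
Qed.

Lemma input_sum_adapted N j i : (i <= j)%N ->
  measurable_fun setT (input (grid R N i) : g_sigma_algebraType (past N j) -> R).
Proof.
move=> /(input_adapted N)[m1 m2]; apply: measurable_funD => //.
exact: measurable_funM.
Qed.

(** A countable union over chains of half-spaces in finitely many values of the
    noise up to the j-th grid time. *)
Lemma low_visit_adapted N j : <<s past N j >> (low_visit N j).
Proof.
pose F (s : seq nat) : set T := [set w | path >=%R (grid R N j) (map (grid R N) s) /\
    input (grid R N j) w - (r1 * r2 - 1) *
      push (input1 ^~ w) (input2 ^~ w) r1 r2 (map (grid R N) s) < C].
have -> : low_visit N j = \bigcup_s F s.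
  by apply/seteqP; split=> w [s]; [exists s|move=> _ Hs; exists s].
apply: (@countable_bigcupT_measurable _ (g_sigma_algebraType (past N j))) => // s.
have [ps|nps] := boolP (path >=%R (grid R N j) (map (grid R N) s)); last first.
  have -> : F s = set0 by apply/seteqP; split=> w // -[]; rewrite (negbTE nps).
  exact: (@measurable0 _ (g_sigma_algebraType (past N j))).
pose f := fun w : g_sigma_algebraType (past N j) => input (grid R N j) w -
  (r1 * r2 - 1) * push (input1 ^~ w) (input2 ^~ w) r1 r2 (map (grid R N) s).
have mf : measurable_fun setT f.
  apply: measurable_funB; first exact: input_sum_adapted.
  apply: measurable_funM => //.
  apply: measurable_push => _ /mapP[i si ->]; apply: input_adapted.
  have : all (fun x => x <= grid R N j) (map (grid R N) s).
    by apply: order_path_min ps => x y z xy yz; exact: le_trans yz xy.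
  by move=> /allP/(_ _ (map_f _ si)); rewrite ler_grid.
have -> : F s = setT `&` f @^-1` `]-oo, C[%classic.
  by apply/seteqP; split=> w; rewrite /F /f /= in_itv //= => -[].
exact: mf.
Qed.

Lemma total_drop_adapted N j : <<s past N (j + 2 ^ N)%N >> (total_drop N j).
Proof.
pose f := fun w : g_sigma_algebraType (past N (j + 2 ^ N)%N) =>
  input (grid R N (j + 2 ^ N)%N) w - input (grid R N j) w.
have mf : measurable_fun setT f.
  by apply: measurable_funB; apply: input_sum_adapted => //; exact: leq_addr.
have -> : total_drop N j = setT `&` f @^-1` `]-oo, - C[%classic.
  by apply/seteqP; split=> w; rewrite /total_drop /f /= in_itv /= grid_add1 //= => -[].
exact: mf.
Qed.

(** The drop over one unit of time is an event about an increment of the noise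
    whose law depends neither on N nor on j. *)
Lemma total_drop_conditional : 0 <= C -> 0 <= mu1 + r2 * mu2 ->
  exists2 q : R, 0 <= q < 1 & forall N j E, <<s past N j >> E ->
    (P (E `&` ~` total_drop N j) <= q%:E * P E)%E.
Proof.
move=> C0 m0; pose sigma := Num.sqrt ((1 + r2 ^+ 2 + 2 * r2 * rho) * 1).
have sigma0 : 0 < sigma by rewrite sqrtr_gt0 mulr1; exact: variance_gt0.
pose x := C + (mu1 + r2 * mu2).
have x0 : 0 <= x by rewrite addr_ge0.
pose K := x / sigma.
have K0 : 0 <= K by rewrite divr_ge0// ltW.
pose p := normal_peak (1 : R) * expR (- (K + 1) ^+ 2 / 2).
have p0 : 0 < p by rewrite mulr_gt0 ?expR_gt0// normal_peak_gt0 ?oner_eq0.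
pose V : set (R * R) := [set y | combination r2 y < - x].
have mV : measurable V.
  have -> : V = setT `&` combination r2 @^-1` `]-oo, - x[%classic.
    by rewrite setTI; apply/seteqP; split=> y; rewrite /V /= in_itv.
  exact: measurable_combination.
have fallE N j : total_drop N j = increment W1 W2 (grid R N j) (grid R N j + 1) @^-1` V.
  apply/seteqP; split=> w; rewrite /total_drop /V /input /input1 /input2 /combination /x /=; lra.
have pD N j : (p%:E <= P (total_drop N j))%E.
  rewrite fallE; apply: (combination_drop BM) => //.
  - exact: grid_ge0.
  - by rewrite ltrDl.
  - by rewrite [_ + 1 - _]addrAC subrr add0r -/sigma /K divfK// gt_eqF.
have mfall N j : measurable (total_drop N j).
  rewrite fallE -[X in measurable X]setTI; exact: measurable_increment.
have p1 : p <= 1 by rewrite -lee_fin; apply: le_trans (pD 0%N 0%N) _; exact: probability_le1.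
exists (1 - p); first by apply/andP; split; lra.
move=> N j E HE.
have [|||mE PE] := increment_independent BM (t := grid R N) (n := j)
    (s := grid R N j + 1) (V := V) _ _ _ mV HE.
- exact: grid_ge0.
- by move=> a b ab; rewrite ler_grid.
- by rewrite lerDl.
rewrite -fallE in PE.
have fP (A : set T) : measurable A -> P A \is a fin_num by move=> mA; exact: fin_num_measure.
have -> : (P (E `&` ~` total_drop N j) = P E - P (E `&` total_drop N j))%E.
  by rewrite -setDE measureD// ltey_eq fP.
have mEf : measurable (E `&` total_drop N j) by exact: measurableI.
move: PE (pD N j).
rewrite -(fineK (fP _ mE)) -(fineK (fP _ mEf)) -(fineK (fP _ (mfall N j))).
rewrite -EFinM => -[PEf]; rewrite lee_fin => pPD.
have aux (a b c : R) : 0 <= a -> p <= b -> c = a * b -> a - c <= (1 - p) * a.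
  by move=> a0 pb ->; nra.
rewrite -EFinB -EFinM lee_fin; apply: aux PEf => //; exact: fine_ge0.
Qed.

End Level.

(** * Brownian motion started at zero does not stay nonnegative *)

Lemma le0_geometric_harmonic (R : realType) (a q c : R) : 0 <= q < 1 ->
  (forall n, a <= q ^+ n + c * n.+1%:R^-1) -> a <= 0.
Proof.
move=> /andP[q0 q1] H.
have cv : (fun n => q ^+ n + c * n.+1%:R^-1) @ \oo --> 0.
  rewrite -[X in _ --> X](_ : 0 + c * 0 = 0); last by rewrite mulr0 addr0.
  apply: cvgD; first by apply: cvg_expr; rewrite ger0_norm.
  by apply: cvgM; [exact: cvg_cst|exact: cvg_harmonic].
rewrite -(cvg_lim (@Rhausdorff R) cv); apply: limr_ge.
  by apply/cvg_ex; exists 0.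
exact: nearW.
Qed.

Lemma prode_le_exp (R : realType) (n : nat) (F : 'I_n -> \bar R) (q : R) :
  0 <= q -> (forall i, (0 <= F i <= q%:E)%E) ->
  (\prod_(i < n) F i <= (q ^+ n)%:E)%E.
Proof.
move=> q0 HF.
have -> : q ^+ n = \prod_(i < n) q by rewrite prodr_const card_ord.
suff [] : (0 <= \prod_(i < n) F i)%E /\ (\prod_(i < n) F i <= (\prod_(i < n) q)%:E)%E by [].
apply: (big_ind2 (fun (x : \bar R) (y : R) => (0 <= x)%E /\ (x <= y%:E)%E)).
- by split; rewrite lee_fin.
- move=> x1 y1 x2 y2 [x10 xy1] [x20 xy2]; split; first exact: mule_ge0.
  by rewrite EFinM; apply: lee_pmul.
- by move=> i _; apply/andP.
Qed.

Section Origin.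
Context d (T : measurableType d) (R : realType) (P : probability T R).
Context (rho r m : R) (W1 W2 : R -> {RV P >-> R}).
Hypothesis BM : planar_BM rho W1 W2.
Hypothesis rho_gtN1 : -1 < rho.
Hypothesis r_gt0 : 0 < r.
Hypothesis m_ge0 : 0 <= m.

(** Let B be the combination with its drift, and take the times t k = tau k ^ 2
    with tau k = L ^ k / L ^ n, for k <= n.  If L is large then B (t k) is at
    most tau k.+1, the order of magnitude of the next increment, except with a
    probability of order 1 / L ^ 2.  When none of these exceptions occurs,
    a nonnegative B requires that no increment falls below - tau k.+1; these
    are n independent events of probability at most 1 - p each.  With L of order
    n the total is (1 - p) ^ n + O(1 / n). *)
Lemma nonneg_combination_null (E : set T) : measurable E ->
  (forall w, E w -> forall t, 0 < t -> 0 <= combination r (W1 t w, W2 t w) + m * t) ->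
  P E = 0%E.
Proof.
move=> mE HE; have m0 := m_ge0.
pose sigma2 := 1 + r ^+ 2 + 2 * r * rho.
have s20 : 0 < sigma2 by exact: variance_gt0.
have ss0 : 0 < Num.sqrt sigma2 by rewrite sqrtr_gt0.
pose K := (2 + m) / Num.sqrt sigma2.
have K0 : 0 <= K by rewrite divr_ge0 ?addr_ge0// ltW.
pose p := normal_peak (1 : R) * expR (- (K + 1) ^+ 2 / 2).
have p0 : 0 < p by rewrite mulr_gt0 ?expR_gt0// normal_peak_gt0 ?oner_eq0.
have mhalf (V : set R) s t : measurable V ->
    measurable (increment W1 W2 s t @^-1` (combination r @^-1` V)).
  move=> mV; rewrite -[X in measurable X]setTI; apply: measurable_increment => //.
  by rewrite -[X in measurable X]setTI; exact: measurable_combination.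
have lowE x : [set y | combination r y < - x] = combination r @^-1` `]-oo, - x[%classic.
  by apply/seteqP; split=> y /=; rewrite in_itv.
have highE x : [set y | x < combination r y] = combination r @^-1` `]x, +oo[%classic.
  by apply/seteqP; split=> y /=; rewrite in_itv /= andbT.
have p1 : p <= 1.
  rewrite -lee_fin; apply: (@le_trans _ _ (P (increment W1 W2 0 1 @^-1`
      [set y | (combination r y < - 0)%R]))).
    by apply: (combination_drop BM) => //; rewrite mulr_ge0.
  by apply: probability_le1; rewrite lowE; exact: mhalf.
have fE : P E \is a fin_num by exact: fin_num_measure.
apply/eqP; rewrite eq_le measure_ge0 andbT -(fineK fE) lee_fin.
apply: (@le0_geometric_harmonic _ _ (1 - p) (6 * sigma2)).
  by apply/andP; split; lra.
move=> n; rewrite -lee_fin fineK//.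
pose L := m + 2 + n%:R.
have n0 : 0 <= n%:R :> R by rewrite ler0n.
have L2 : 2 <= L by rewrite /L; lra.
have L0 : 0 < L by lra.
pose tau k := L ^+ k / L ^+ n.
have tau0 k : 0 < tau k by rewrite divr_gt0// exprn_gt0.
have tau_ge0 k : 0 <= tau k by exact: ltW.
have tauS k : tau k.+1 = L * tau k by rewrite /tau exprS mulrA.
have tau1 k : (k <= n)%N -> tau k <= 1.
  move=> kn; rewrite ler_pdivrMr ?exprn_gt0// mul1r.
  by apply: ler_weXn2l => //; lra.
pose t k := tau k ^+ 2.
have t0 k : 0 < t k by rewrite exprn_gt0.
have tmono : {homo t : i j / (i <= j)%N >-> i <= j}.
  move=> i j ij; rewrite ler_sqr ?nnegrE//.
  by rewrite ler_pM2r ?invr_gt0 ?exprn_gt0//; apply: ler_weXn2l => //; lra.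
(* Falling by x k is losing tau k.+1 after the drift has been added. *)
pose x k := tau k.+1 + m * (t k.+1 - t k).
pose fall k := increment W1 W2 (t k) (t k.+1) @^-1` [set y | (combination r y < - x k)%R].
pose rise k := increment W1 W2 0 (t k) @^-1`
  [set y | ((n%:R + 2) * tau k < combination r y)%R].
have mfall k : measurable (fall k) by rewrite /fall lowE; exact: mhalf.
have mrise k : measurable (rise k) by rewrite /rise highE; exact: mhalf.
have Pfall k : (k < n)%N -> (p%:E <= P (fall k))%E.
  move=> kn; have tauk := tau0 k; have tauk1 := tau1 _ kn.
  have tt : t k < t k.+1 by rewrite /t ltr_sqr ?nnegrE// tauS; nra.
  apply: (combination_drop BM) => //; first exact: ltW.
  rewrite sqrtrM; last exact: ltW.
  rewrite -/sigma2 /K mulrA divfK ?gt_eqF//.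
  set D := Num.sqrt _.
  have D0 : 0 <= D by exact: sqrtr_ge0.
  have DE : D ^+ 2 = t k.+1 - t k by rewrite sqr_sqrtr// subr_ge0 ltW.
  have tkE : t k.+1 = L ^+ 2 * t k by rewrite /t tauS exprMn.
  have tk1 : t k.+1 <= 1 by rewrite /t expr_le1// ltW.
  have L4 : 4 <= L ^+ 2 by nra.
  have tk := t0 k.
  have D1 : D <= 1 by rewrite -(expr_le1 (n := 2))//; lra.
  have Dx : tau k.+1 / 2 <= D.
    rewrite -ler_sqr ?nnegrE//; last by rewrite divr_ge0// ltW.
    by rewrite expr_div_n DE -/(t k.+1) tkE; nra.
  have mD : m * D ^+ 2 <= m * D by rewrite ler_wpM2l// expr2 ler_piMr.
  by rewrite /x -DE mulrDl; lra.
have Prise k : (P (rise k) <= (6 * sigma2 / (n%:R + 2) ^+ 2)%:E)%E.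
  have tauk := tau0 k.
  apply: (le_trans (combination_rise BM rho_gtN1 r_gt0 _ _ _)) => //.
    by rewrite mulr_gt0//; lra.
  rewrite lee_fin subr0 -/sigma2 exprMn /t le_eqVlt; apply/orP; left; apply/eqP.
  by field; rewrite gt_eqF//= gt_eqF//; lra.
pose stay := \bigcap_(k in [set: 'I_n]) (increment W1 W2 (t k) (t k.+1) @^-1`
  (~` [set y | combination r y < - x k])).
have mV k : measurable (~` [set y | combination r y < - x k]).
  apply: measurableC; rewrite lowE -[X in measurable X]setTI.
  exact: measurable_combination.
have mstay : measurable stay.
  apply: fin_bigcap_measurable => [|k _]; first exact: finite_finset.
   rewrite -[X in measurable X]setTI.
  exact: measurable_increment.
have Pstay : (P stay <= ((1 - p) ^+ n)%:E)%E.
  have := planar_BM_independent BM (ltW (t0 0%N)) tmono (n := n) (fun k : 'I_n => mV k).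
  move=> ->; apply: prode_le_exp; first lra.
  move=> k; apply/andP; split; first exact: measure_ge0.
  have -> : (fun w => (W1 (t k.+1) w - W1 (t k) w, W2 (t k.+1) w - W2 (t k) w)) @^-1`
    (~` [set y | combination r y < - x k]) = ~` fall k by [].
  by rewrite probability_setC// EFinB leeB// Pfall.
pose F k := if (k < n)%N then rise k else stay.
have mF k : measurable (F k) by rewrite /F; case: ifP.
apply: (@le_trans _ _ (\sum_(k < n.+1) P (F k))%E).
  apply: content_subadditive => //.
  move=> w Ew; rewrite -(bigcup_mkord n.+1 F).
  have [[k kn rk]|nrise] := pselect (exists2 k, (k < n)%N & rise k w).
    by exists k; rewrite /= ?ltnS ?(ltnW kn)// /F kn.
  exists n => //=; rewrite /F ltnn => k _ /=; rewrite /combination /x /= => Hk.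
  have ktn := ltn_ord k.
  have : combination r (W1 (t k) w, W2 (t k) w) <= (n%:R + 2) * tau k.
    rewrite leNgt; apply/negP => Hr; apply: nrise; exists (val k) => //.
    rewrite /rise /increment /=; have [-> ->] := planar_BM0 BM w.
    by rewrite !subr0.
  have := HE w Ew _ (t0 k.+1); have tauk := tau0 k.
  have : t k <= tau k by rewrite /t; have := tau1 _ (ltnW ktn); nra.
  move: Hk; rewrite /combination /= tauS /L => Hk tt H1 H2.
  by nra.
rewrite big_ord_recr /= addeC EFinD; apply: leeD.
  by rewrite /F ltnn.
apply: (@le_trans _ _ (\sum_(k < n) (6 * sigma2 / (n%:R + 2) ^+ 2)%:E)%E).
  by apply: lee_sum => k _; rewrite /F ltn_ord.
rewrite sumEFin lee_fin sumr_const card_ord -[leLHS]mulr_natr -[leLHS]mulrA.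
rewrite ler_wpM2l ?mulr_ge0 ?(ltW s20)// ler_pdivrMl; last by rewrite exprn_gt0//; lra.
by rewrite ler_pdivlMr ?ltr0n// -natr1; nra.
Qed.

End Origin.

(** * Recurrence of continuous paths along dyadic times *)

Definition returns_below (R : realType) (f : R -> R) (C : R) :=
  forall n : nat, exists N j, n%:R <= grid R N j /\ f (grid R N j) < C.

Lemma not_tends_returns (R : realType) (f : R -> R) :
  continuous_path f -> ~ (f t @[t --> +oo] --> +oo) ->
  exists C : nat, returns_below f C%:R.
Proof.
move=> cf /cvgryPge; rewrite -existsNE => -[A /=].
have [C AC] : exists C : nat, A <= C%:R.
  exists (Num.bound `|A|); apply: le_trans (ler_norm A) _.
  by apply: ltW; exact: archi_boundP.
move=> nA; exists C => n; apply: contrapT => nret; apply: nA.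
exists n%:R; split; first exact: num_real.
move=> t nt; rewrite leNgt; apply/negP => ftA; apply: nret.
have t0 : 0 <= t by apply: ltW; apply: le_lt_trans nt; exact: ler0n.
have [|h h0 Hh] := @continuous_path_near _ f t (A - f t) cf t0; first by lra.
have [|N [j /andP[gj1 gj2]]] := @grid_dense _ t (t + h / 2) t0; first by lra.
exists N, j; split; first by apply: ltW; exact: lt_trans gj1.
have : `|f t - f (grid R N j)| < A - f t.
  by apply: Hh; [exact: grid_ge0|rewrite ltr_norml; apply/andP; split; lra].
by rewrite ltr_norml => /andP[? _]; lra.
Qed.

Lemma returns_liminf (R : realType) (f : R -> R) (C : R) :
  returns_below f C -> (limf_einf (fun t => (f t)%:E) (pinfty_nbhs R) < +oo)%E.
Proof.
move=> ret; apply: (@le_lt_trans _ _ C%:E); last exact: ltry.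
rewrite limf_einfE; apply: ge_ereal_sup => _ [V [M [_ MV]] <-].
have [N [j [nj fj]]] := ret (Num.bound `|M|).
apply: (@le_trans _ _ (f (grid R N j))%:E); last by rewrite lee_fin ltW.
apply: ereal_inf_lbound; exists (grid R N j) => //; apply: MV.
apply: lt_le_trans nj; apply: le_lt_trans (ler_norm M) _; exact: archi_boundP.
Qed.

Lemma tends_liminf (R : realType) (f : R -> R) :
  f t @[t --> +oo] --> +oo ->
  limf_einf (fun t => (f t)%:E) (pinfty_nbhs R) = +oo%E.
Proof.
move=> /cvgryPge tf; apply/eqyP => A _; rewrite limf_einfE.
have /= VA := tf A.
apply: (@le_trans _ _ (ereal_inf ((fun t => (f t)%:E) @` [set t | A <= f t]))).
  by apply: le_ereal_inf_tmp => _ [t At <-]; rewrite lee_fin.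
by apply: ereal_sup_ubound; exists [set t | A <= f t].
Qed.

(** * Surviving paths *)
Section Survival.
Context d (T : measurableType d) (R : realType) (P : probability T R).
Context (mu1 mu2 rho r1 r2 u v : R) (W1 W2 l1 l2 Z1 Z2 : R -> {RV P >-> R}).
Hypothesis HZ : absorbed_reflected_BM mu1 mu2 rho r1 r2 u v W1 W2 l1 l2 Z1 Z2.
Hypotheses (mu1_gt0 : 0 < mu1) (mu2_gt0 : 0 < mu2) (rho_gtN1 : -1 < rho).
Hypotheses (r1_gt0 : 0 < r1) (r2_gt0 : 0 < r2) (r1r2_ge1 : 1 <= r1 * r2).

Definition survival : set T :=
  [set w | absorption_time (Z1 ^~ w) (Z2 ^~ w) = +oo%E].

Lemma survival_neq0 w t : survival w -> 0 < t -> ~ (Z1 t w = 0 /\ Z2 t w = 0).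
Proof.
move=> Sw t0 [z1 z2]; have : (absorption_time (Z1 ^~ w) (Z2 ^~ w) <= t%:E)%E.
  by apply: ereal_inf_lbound; exists t.
by rewrite Sw.
Qed.

(** After absorption the process stays at the origin, so survival can be read at
    the integer times. *)
Lemma survivalE :
  survival = \bigcap_n ~` (Z1 n.+1%:R @^-1` [set 0] `&` Z2 n.+1%:R @^-1` [set 0]).
Proof.
apply/seteqP; split=> w Hw.
  by move=> n _; exact: survival_neq0.
rewrite /survival /=.
have T0 : (0 <= absorption_time (Z1 ^~ w) (Z2 ^~ w))%E.
  by apply: le_ereal_inf_tmp => _ [t [t0 _ _] <-]; rewrite lee_fin ltW.
move: T0; case E : (absorption_time _ _) => [t| |] //; rewrite lee_fin => t0.
exfalso; apply: (Hw (Num.bound t)) => //; apply: (reflected_BM_after HZ) => //.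
rewrite E lee_fin; apply: ltW; apply: lt_trans (archi_boundP t0) _.
by rewrite ltr_nat.
Qed.

Lemma measurable_survival : measurable survival.
Proof.
rewrite survivalE; apply: bigcapT_measurable => n; apply: measurableC.
by apply: measurableI; rewrite -[X in measurable X]setTI;
  exact: measurable_funP.
Qed.

Local Notation x1 := (input1 mu1 u W1).
Local Notation x2 := (input2 mu2 v W2).

Lemma survival_eq w t : survival w -> 0 <= t ->
  [/\ Z1 t w = x1 t w + l1 t w - r2 * l2 t w,
      Z2 t w = x2 t w + l2 t w - r1 * l1 t w, 0 <= Z1 t w & 0 <= Z2 t w].
Proof.
move=> Sw t0; have := reflected_BM_before HZ (w := w) t0.
rewrite Sw leey => /(_ isT)[z1 z10 z2 z20]; split=> //.
by rewrite z2 /input2; ring.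
Qed.

Lemma survival_reflected_path w : survival w ->
  reflected_path r1 r2 (x1 ^~ w) (x2 ^~ w) (l1 ^~ w) (l2 ^~ w).
Proof.
move=> Sw; have [reg1 reg2] := reflected_BM_regulators HZ w.
have [cW1 cW2] := planar_BM_continuous (reflected_BM_noise HZ) w.
split.
- by split; exact: affine_path_continuous.
- by move=> t t0; have [<- <-] := survival_eq Sw t0.
- case: reg1 => l0 cl mono inc; split=> // s t s0 st /(inc _ _ s0 st)[x /andP[sx xt] zx].
  by exists x; [apply/andP|have [<- _] := survival_eq Sw (le_trans s0 sx)].
- case: reg2 => l0 cl mono inc; split=> // s t s0 st /(inc _ _ s0 st)[x /andP[sx xt] zx].
  by exists x; [apply/andP|have [_ <-] := survival_eq Sw (le_trans s0 sx)].
Qed.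

Local Notation total := (input mu1 mu2 r2 u v W1 W2).

Lemma survival_total w t : survival w -> 0 <= t ->
  Z1 t w + r2 * Z2 t w = total t w - (r1 * r2 - 1) * l1 t w.
Proof.
by move=> Sw t0; have [-> -> _ _] := survival_eq Sw t0; rewrite /input; ring.
Qed.

Lemma survival_regulator_ge0 w t : 0 <= t -> 0 <= l1 t w.
Proof.
move=> t0; have [[l0 _ mono _] _] := reflected_BM_regulators HZ w.
by rewrite -l0 mono.
Qed.

Lemma origin_no_survival : u = 0 -> v = 0 -> P survival = 0%E.
Proof.
move=> u0 v0; apply: (nonneg_combination_null (reflected_BM_noise HZ)
  rho_gtN1 r2_gt0 (m := mu1 + r2 * mu2)).
- by rewrite addr_ge0 ?mulr_ge0// ltW.
- exact: measurable_survival.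
move=> w Sw t t0; have := survival_total Sw (ltW t0).
have [_ _ z10 z20] := survival_eq Sw (ltW t0).
have : 0 <= (r1 * r2 - 1) * l1 t w.
  by rewrite mulr_ge0 ?subr_ge0// survival_regulator_ge0// ltW.
have : 0 <= r2 * Z2 t w by rewrite mulr_ge0// ltW.
by rewrite /input /input1 /input2 u0 v0 /combination /=; lra.
Qed.

Local Notation low C := (low_visit mu1 mu2 r1 r2 u v C W1 W2).
Local Notation fall C := (total_drop mu1 mu2 r2 u v C W1 W2).

(** From a visit of Z1 + r2 * Z2 below C, a drop of the total motion by C in one
    unit of time would make Z1 + r2 * Z2 negative, since l1 only lowers it. *)
Lemma survival_no_fall C N j w : survival w -> ~ (low C N j `&` fall C N j) w.
Proof.
move=> Sw [[s [ps Hs]] fallw]; have t0 := grid_ge0 R N j.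
have := push_le (ltW r1_gt0) (ltW r2_gt0) t0 _ (survival_reflected_path Sw) ps.
have s0 : {in map (grid R N) s, forall a, 0 <= a}.
  by move=> _ /mapP[i _ ->]; exact: grid_ge0.
move=> /(_ s0); have : 0 <= r1 * r2 - 1 by rewrite subr_ge0.
move=> delta0 /(ler_wpM2l delta0) Hpush.
have t10 : 0 <= grid R N j + 1 by rewrite addr_ge0.
have mono : l1 (grid R N j) w <= l1 (grid R N j + 1) w.
  by have [[_ _ mono _] _] := reflected_BM_regulators HZ w; apply: mono => //; rewrite lerDl.
have {}mono := ler_wpM2l delta0 mono.
have [_ _ z10 z20] := survival_eq Sw t10.
have : 0 <= Z1 (grid R N j + 1) w + r2 * Z2 (grid R N j + 1) w.
  by rewrite addr_ge0// mulr_ge0// ltW.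
rewrite (survival_total Sw t10).
by move: fallw; rewrite /total_drop /=; lra.
Qed.

(** An actual visit below C at a dyadic time leaves some room under C, which
    absorbs the error of a chain for l1; all finer grids contain that chain. *)
Lemma survival_low C N j w : (u, v) != (0, 0) -> survival w ->
  Z1 (grid R N j) w + r2 * Z2 (grid R N j) w < C ->
  exists N0, forall N', (N0 <= N')%N -> (N <= N')%N -> low C N' (j * 2 ^ (N' - N)) w.
Proof.
move=> uv0 Sw; have t0 := grid_ge0 R N j; rewrite (survival_total Sw t0) => HC.
have delta0 : 0 <= r1 * r2 - 1 by rewrite subr_ge0.
have z_neq0 t : 0 <= t -> ~ (x1 t w + l1 t w - r2 * l2 t w = 0 /\
    x2 t w + l2 t w - r1 * l1 t w = 0).
  rewrite le_eqVlt => /predU1P[<-|tgt0]; last first.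
    have [<- <- _ _] := survival_eq Sw (ltW tgt0); exact: survival_neq0.
  have [[l10 _ _ _] [l20 _ _ _]] := reflected_BM_regulators HZ w.
  have [W10 W20] := planar_BM0 (reflected_BM_noise HZ) w.
  rewrite l10 l20 /input1 /input2 W10 W20 !mulr0 !subr0 !addr0 => -[u0 v0].
  by move: uv0; rewrite u0 v0 eqxx.
have [att _] := reflected_path_attained r1_gt0 r2_gt0 (survival_reflected_path Sw) z_neq0 t0.
set gap := C - (total (grid R N j) w - (r1 * r2 - 1) * l1 (grid R N j) w).
have gap0 : 0 < gap by rewrite subr_gt0.
have rr0 : 0 < r1 * r2 by rewrite mulr_gt0.
(* The error is multiplied by r1 * r2 - 1 < r1 * r2. *)
have [|N0 [s [ps Hs]]] := att (gap / (r1 * r2)); first by rewrite divr_gt0.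
exists N0 => N' N0N' NN'.
have gE : grid R N' (j * 2 ^ (N' - N)) = grid R N j.
  by rewrite [RHS](grid_refine _ _ (N' - N)) subnKC.
have sE : map (grid R N') (map (muln^~ (2 ^ (N' - N0))%N) s) = map (grid R N0) s.
  rewrite -map_comp; apply: eq_map => k /=.
  by rewrite [in RHS](grid_refine _ _ (N' - N0)) subnKC.
exists (map (muln^~ (2 ^ (N' - N0))%N) s); rewrite sE gE; split=> //.
set p := push _ _ _ _ _ in Hs *.
have : (r1 * r2 - 1) * (l1 (grid R N j) w - gap / (r1 * r2)) <= (r1 * r2 - 1) * p.
  by rewrite ler_wpM2l// ltW.
have : (r1 * r2 - 1) * (gap / (r1 * r2)) < gap.
  by rewrite mulrA ltr_pdivrMr// [ltRHS]mulrC ltr_pM2r//; lra.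
rewrite mulrBr => H1 H2.
have gapE : gap = C - (total (grid R N j) w - (r1 * r2 - 1) * l1 (grid R N j) w) by [].
by lra.
Qed.

Definition recurrence (C : R) : set T :=
  [set w | returns_below (fun t => enorm2 (Z1 t w) (Z2 t w)) C].

Lemma measurable_enorm t : measurable_fun setT (fun w => enorm2 (Z1 t w) (Z2 t w)).
Proof.
apply: (@measurableT_comp _ _ _ _ _ _ (@Num.sqrt R)).
  by apply: continuous_measurable_fun; exact: sqrt_continuous.
by apply: measurable_funD; exact: measurable_funX.
Qed.

Lemma measurable_recurrence C : measurable (recurrence C).
Proof.
pose F (n N j : nat) : set T :=
  [set w | n%:R <= grid R N j /\ enorm2 (Z1 (grid R N j) w) (Z2 (grid R N j) w) < C].
have -> : recurrence C = \bigcap_n \bigcup_N \bigcup_j F n N j.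
  apply/seteqP; split=> w Hw n => [_|].
    by have [N [j Hj]] := Hw n; exists N => //; exists j.
  by have [N _ [j _ Hj]] := Hw n I; exists N, j.
apply: bigcapT_measurable => n; apply: bigcupT_measurable => N.
apply: bigcupT_measurable => j.
have [nj|nj] := boolP (n%:R <= grid R N j); last first.
  by rewrite (_ : F n N j = set0)//; apply/seteqP; split=> w // -[]; rewrite (negbTE nj).
have -> : F n N j = setT `&` (fun w => enorm2 (Z1 (grid R N j) w) (Z2 (grid R N j) w))
    @^-1` `]-oo, C[%classic.
  by apply/seteqP; split=> w; rewrite /F /= in_itv /= => -[].
exact: measurable_enorm.
Qed.

Lemma enorm2_ge (x y : R) : x <= enorm2 x y /\ y <= enorm2 x y.
Proof.
split; (apply: le_trans (ler_norm _) _; rewrite -sqrtr_sqr ler_wsqrtr//).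
  by rewrite lerDl sqr_ge0.
by rewrite lerDr sqr_ge0.
Qed.

(** Starting after any integer time a, one picks the i visits successively, and
    takes a grid on which all of them are certified. *)
Lemma recurrence_visits C i a w : (u, v) != (0, 0) -> survival w -> recurrence C w ->
  exists N0, forall N, (N0 <= N)%N ->
    spaced_visits (low ((1 + r2) * C) N) (2 ^ N) i (a * 2 ^ N) w.
Proof.
move=> uv0 Sw rec; elim: i a => [|i IH] a; first by exists 0%N.
have [N1 [j [aj Cj]]] := rec a.
have [|N2 HN2] := @survival_low ((1 + r2) * C) N1 j w uv0 Sw.
  have [zC1 zC2] := enorm2_ge (Z1 (grid R N1 j) w) (Z2 (grid R N1 j) w).
  have := ler_wpM2l (ltW r2_gt0) zC2.
  have := r2_gt0; nra.
pose b := (Num.bound (grid R N1 j)).+1.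
have [N3 HN3] := IH b.
exists (maxn N1 (maxn N2 N3)) => N; rewrite !geq_max => /and3P[N1N N2N N3N].
have jE : grid R N (j * 2 ^ (N - N1)) = grid R N1 j.
  by rewrite [RHS](grid_refine _ _ (N - N1)) subnKC.
have nE n : n%:R = grid R N (n * 2 ^ N).
  by rewrite /grid natrM natrX mulfK// expf_neq0// pnatr_eq0.
have aJ : (a * 2 ^ N <= j * 2 ^ (N - N1))%N by rewrite -(ler_grid R N) -nE jE.
exists (j * 2 ^ (N - N1) - a * 2 ^ N)%N => //; rewrite subnKC//; split; first exact: HN2.
apply: spaced_visits_le (HN3 _ N3N).
rewrite /b mulSn addnC leq_add2l -(ler_grid R N) -nE jE.
by apply: ltW; apply: archi_boundP; exact: grid_ge0.
Qed.

(** Each of the i visits counted on a fine grid escapes a drop, with probability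
    at most q; i is arbitrary. *)
Lemma survival_recurrence_null C : 0 <= C -> P (survival `&` recurrence C) = 0%E.
Proof.
move=> C0; have mE : measurable (survival `&` recurrence C).
  by apply: measurableI; [exact: measurable_survival|exact: measurable_recurrence].
have [[u0 v0]|uv0] := eqVneq (u, v) (0, 0).
  apply/eqP; rewrite eq_le measure_ge0 andbT -(origin_no_survival u0 v0).
  by apply: le_measure; rewrite ?inE//; exact: measurable_survival.
pose C' := (1 + r2) * C.
have [||q q01 Hq] := @total_drop_conditional _ _ _ P rho mu1 mu2 r2 u v C' W1 W2
    (reflected_BM_noise HZ) rho_gtN1 r2_gt0.
- by rewrite mulr_ge0// addr_ge0// ltW.
- by rewrite addr_ge0 ?mulr_ge0// ltW.
have q0 : 0 <= q by case/andP: q01.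
have fE : P (survival `&` recurrence C) \is a fin_num by exact: fin_num_measure.
apply/eqP; rewrite eq_le measure_ge0 andbT -(fineK fE) lee_fin.
apply: (@le0_geometric_harmonic _ _ q 0) => // i.
rewrite mul0r addr0 -lee_fin fineK//.
pose A N := spaced_visits (low C' N) (2 ^ N) i 0 `&`
  \bigcap_k ~` (low C' N k `&` fall C' N k).
have Gm N j : <<s increment_rectangles W1 W2 (grid R N) j >> `<=` measurable.
  move=> E HE; have [] := increment_independent (reflected_BM_noise HZ)
    (t := grid R N) (n := j) (s := grid R N j) _ _ (lexx _) measurableT HE => //.
  - exact: grid_ge0.
  - by move=> k l kl; rewrite ler_grid.
have Alow N j : <<s increment_rectangles W1 W2 (grid R N) j >> (low C' N j).
  exact: (low_visit_adapted _ _ _ _ _ _ _ (reflected_BM_noise HZ)).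
have Afall N j : <<s increment_rectangles W1 W2 (grid R N) (j + 2 ^ N)%N >> (fall C' N j).
  exact: (total_drop_adapted _ _ _ _ _ _ (reflected_BM_noise HZ)).
apply: (@liminf_probability_le _ _ _ P A) => //.
- move=> N; apply: measurableI.
    by apply: measurable_spaced_visits; [exact: Gm|exact: Alow].
  apply: bigcapT_measurable => k; apply/measurableC/measurableI.
    exact: Gm (Alow N k).
  exact: Gm (Afall N k).
- move=> N.
  have := @spaced_visits_nodrop_le _ _ _ P
    (increment_rectangles W1 W2 (grid R N)) (low C' N) (fall C' N) (2 ^ N) q
    (Gm N) (@increment_rectangles_nondecreasing _ _ _ _ W1 W2 _)
    (Alow N) (Afall N) q0 (Hq N) i 0%N setT.
  rewrite setTI probability_setT mule1; apply.
  exact: (@measurableT _ (g_sigma_algebraType _)).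
move=> w [Sw rec]; have [N0 HN0] := recurrence_visits i 0 uv0 Sw rec.
exists N0 => N N0N; split; first by have := HN0 N N0N; rewrite mul0n.
by move=> k _; exact: survival_no_fall.
Qed.

Lemma survival_enorm_continuous w : survival w ->
  continuous_path (fun t => enorm2 (Z1 t w) (Z2 t w)).
Proof.
move=> Sw; have H := survival_reflected_path Sw.
pose z1 t := x1 t w + l1 t w - r2 * l2 t w.
pose z2 t := x2 t w + l2 t w - r1 * l1 t w.
have cz1 : continuous_path z1 := reflected_path_cont H.
have cz2 : continuous_path z2 := reflected_path_cont (reflected_path_sym H).
have cz : continuous_path (fun t => enorm2 (z1 t) (z2 t)).
  apply: within_continuous_comp => [x _|]; first exact: sqrt_continuous.
  by apply: within_continuousD => t; rewrite /GRing.exp /=; apply: cvgM; (exact: cz1 || exact: cz2).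
apply: subspace_eq_continuous cz => t; rewrite inE /= in_itv /= andbT => t0.
by have [e1 e2 _ _] := survival_eq Sw t0; rewrite /from_subspace /= e1 e2.
Qed.

Lemma survival_tendsP w : survival w ->
  [<-> ~ tends_to_infinity (Z1 ^~ w) (Z2 ^~ w);
       (\bigcup_C recurrence C%:R) w;
       (liminf_norm (Z1 ^~ w) (Z2 ^~ w) < +oo)%E].
Proof.
move=> Sw; tfae.
- by move=> /(not_tends_returns (survival_enorm_continuous Sw))[C HC]; exists C.
- by move=> [C _]; exact: returns_liminf.
- by move=> + tz; rewrite /liminf_norm (tends_liminf tz).
Qed.

End Survival.

Theorem theorem10 (R : realType) (d : measure_display)
    (Omega : measurableType d) (P : probability Omega R)
    (mu1 mu2 rho r1 r2 : R)
    (mu1_gt0 : 0 < mu1) (mu2_gt0 : 0 < mu2)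
    (rho_gtN1 : -1 < rho) (rho_lt1 : rho < 1)
    (r1_gt0 : 0 < r1) (r2_gt0 : 0 < r2) (r1r2_ge1 : 1 <= r1 * r2)
    (u v : R) (u_ge0 : 0 <= u) (v_ge0 : 0 <= v)
    (W1 W2 l1 l2 Z1 Z2 : R -> {RV P >-> R})
    (HZ : absorbed_reflected_BM mu1 mu2 rho r1 r2 u v W1 W2 l1 l2 Z1 Z2) :
  let T (w : Omega) : \bar R := absorption_time (Z1 ^~ w) (Z2 ^~ w) in
  [/\ {ae P, forall w, T w = +oo%E -> tends_to_infinity (Z1 ^~ w) (Z2 ^~ w)},
      P [set w | T w = +oo%E] != 0%E ->
        cond_prob P [set w | tends_to_infinity (Z1 ^~ w) (Z2 ^~ w)]
                    [set w | T w = +oo%E] = 1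
    & P [set w | (liminf_norm (Z1 ^~ w) (Z2 ^~ w) < +oo)%E /\ T w = +oo%E]
        = 0%E].
Proof.
move=> T0; pose S := survival Z1 Z2.
pose E := S `&` \bigcup_C recurrence Z1 Z2 C%:R.
have mS : measurable S := measurable_survival HZ.
have mE : measurable E.
  by apply: measurableI => //; apply: bigcupT_measurable => C; exact: measurable_recurrence.
have PE : P E = 0%E.
  apply/eqP; rewrite eq_le measure_ge0 andbT.
  have mSC (C : nat) : measurable (S `&` recurrence Z1 Z2 C%:R).
    by apply: measurableI => //; exact: measurable_recurrence.
  rewrite /E setI_bigcupr.
  apply: (@le_trans _ _ (\sum_(0 <= C <oo) P (S `&` recurrence Z1 Z2 C%:R))%E).
    by apply: measure_sigma_subadditive => //; exact: bigcupT_measurable.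
  rewrite eseries0// => C _ _.
  exact: (survival_recurrence_null HZ).
have tendsP w : S w -> ~ tends_to_infinity (Z1 ^~ w) (Z2 ^~ w) <-> E w.
  move=> Sw; have tf := survival_tendsP HZ Sw; split.
    by move=> /(tf 0%N 1%N); split.
  by move=> [_ Rw]; apply/(tf 0%N 1%N).
split.
- exists E; split=> // w /= H; apply/tendsP.
    by apply: contrapT => nS; apply: H => Sw.
  by move=> tz; apply: H.
- move=> PS0; rewrite /cond_prob.
  have -> : [set w | tends_to_infinity (Z1 ^~ w) (Z2 ^~ w)] `&` [set w | T0 w = +oo%E]
      = S `\` E.
    apply/seteqP; split=> w /=.
      by move=> [tz Sw]; split=> // /(tendsP w Sw).
    move=> [Sw nE]; split=> //; apply: contrapT => /(tendsP w Sw); exact: nE.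
  have -> : P (S `\` E) = P S.
    rewrite measureD//; last by rewrite ltey_eq fin_num_measure.
    have -> : S `&` E = E by apply: setIidr; exact: subIsetl.
    by rewrite [X in (_ - X)%E]PE sube0.
  rewrite divff// fine_eq0//; exact: fin_num_measure.
rewrite (_ : [set w | _] = E)//; apply/seteqP; split=> w /=.
  by move=> [lw Sw]; split=> //; have tf := survival_tendsP HZ Sw; apply/(tf 1%N 2%N).
by move=> [Sw Rw]; split=> //; have tf := survival_tendsP HZ Sw; apply/(tf 1%N 2%N).
Qed.
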